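(* Let $p$ be a Wolstenholme prime. Then $$\begin{aligned}\binom{2p-1}{p-1} \equiv{}& 1 - p^3\left(\frac{8}{3}B_{p-3} - 3B_{2p-4} + \frac{8}{5}B_{3p-5} - \frac{1}{3}B_{4p-6}\right)\\ &- p^4\left(\frac{8}{9}B_{p-3} - \frac{3}{2}B_{2p-4} + \frac{24}{25}B_{3p-5} - \frac{2}{9}B_{4p-6}\right)\\ &- p^5\left(\frac{8}{27}B_{p-3} - \frac{3}{4}B_{2p-4} + \frac{72}{125}B_{3p-5} - \frac{4}{27}B_{4p-6} + \frac{12}{5}B_{p-5} - B_{2p-6}\right)\\ &- \frac{2}{25}p^6 B_{p-5} \pmod{p^7}.\end{aligned}$$
   Context: A prime $p$ is called a Wolstenholme prime if $\binom{2p-1}{p-1}\equiv 1 \pmod{p^4}$. The Bernoulli numbers $B_k$ are defined by $\sum_{k=0}^{\infty}B_k\frac{x^k}{k!}=\frac{x}{e^x-1}$ (so $B_0=1$, $B_1=-\frac12$, $B_2=\frac16$). Congruences between rational numbers modulo $p^e$ are understood in the ring of rationals with denominator prime to $p$: $a\equiv b \pmod{p^e}$ means that $a-b$, written in reduced form, has numerator divisible by $p^e$ and denominator prime to $p$. *)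

(* Defs.v *)
From HB Require Import structures.
From mathcomp Require Import all_boot all_order all_algebra.

Set Implicit Arguments.
Unset Strict Implicit.
Unset Printing Implicit Defensive.

Import Order.TTheory GRing.Theory Num.Theory.

Local Open Scope ring_scope.

Definition wolstenholme_prime (p : nat) : bool :=
  prime p && ('C(2 * p - 1, p - 1) == 1 %[mod p ^ 4])%N.

(* A formal power series over the rationals is its coefficient sequence. *)
Definition fps : Type := nat -> rat.

Definition fps_mul (f g : fps) : fps :=
  fun n => \sum_(k < n.+1) f k * g (n - k)%N.

Definition fps_X : fps := fun n => (n == 1%N)%:R.

(* The series \sum_k a_k x^k / k! *)
Definition fps_egf (a : nat -> rat) : fps := fun k => a k / (k`!)%:R.

(* e^x - 1 *)
Definition fps_expm1 : fps := fun k => ((k`!)%:R)^-1 - (k == 0%N)%:R.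

(* The equation \sum_k B_k x^k / k! = x / (e^x - 1) is stated with the
   denominator cleared: e^x - 1 has no constant term, hence no inverse among
   power series, but power series over a field form an integral domain, so the
   quotient is determined by the product. Existence and uniqueness of B are
   bernoulli_seq_exists and bernoulli_seq_unique. *)
Definition bernoulli_seq (B : nat -> rat) : Prop :=
  forall n, fps_mul (fps_egf B) fps_expm1 n = fps_X n.

(* a = b mod p^e among the rationals with denominator prime to p; numq and denq
   are the numerator and denominator in reduced form. *)
Definition ratcong (p e : nat) (a b : rat) : bool :=
  (p%:Z ^+ e %| numq (a - b))%Z && coprimez p%:Z (denq (a - b)).

Lemma bernoulli_seqS (B : nat -> rat) (n : nat) :
  fps_mul (fps_egf B) fps_expm1 n.+1 =
  \sum_(k < n) fps_egf B k / ((n.+1 - k)`!)%:R + fps_egf B n.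
Proof.
rewrite /fps_mul big_ord_recr /= subnn /fps_expm1 fact0 eqxx subrr mulr0 addr0.
rewrite big_ord_recr /= subSnn invr1 subr0 mulr1; congr (_ + _).
apply: eq_bigr => i _; have lt_in := ltn_ord i.
by rewrite subn_eq0 leqNgt (ltn_trans lt_in) // subr0.
Qed.

Lemma bernoulli_seq0 (B : nat -> rat) :
  fps_mul (fps_egf B) fps_expm1 0 = 0.
Proof. by rewrite /fps_mul big_ord1 /= /fps_expm1 fact0 eqxx invr1 subrr mulr0. Qed.

Lemma bernoulli_seq_unique (B B' : nat -> rat) :
  bernoulli_seq B -> bernoulli_seq B' -> forall n, B n = B' n.
Proof.
move=> hB hB' n; have fn0 m : (m`!)%:R != 0 :> rat.
  by rewrite pnatr_eq0 -lt0n fact_gt0.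
elim/ltn_ind: n => n IHn.
have := hB n.+1; rewrite -(hB' n.+1) !bernoulli_seqS.
rewrite (eq_bigr (fun k : 'I_n => fps_egf B' k / ((n.+1 - k)`!)%:R)); last first.
  by move=> i _; rewrite /fps_egf IHn.
by move/addrI/(mulIf (invr_neq0 (fn0 n))).
Qed.

Lemma bernoulli_seq_exists : exists B : nat -> rat, bernoulli_seq B.
Proof.
pose nxt (s : seq rat) : rat := (size s)`!%:R *
  ((size s == 0%N)%:R
   - \sum_(k < size s) fps_egf (nth 0 s) k / (((size s).+1 - k)`!)%:R).
pose pre n := iter n (fun s => rcons s (nxt s)) [::].
have szp n : size (pre n) = n by elim: n => //= n IHn; rewrite size_rcons IHn.
pose B n := nxt (pre n).
have nthp n k : (k < n)%N -> nth 0 (pre n) k = B k.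
  elim: n => //= n IHn; rewrite ltnS leq_eqVlt nth_rcons szp.
  by case: eqP => [->|_ /= lt_kn]; rewrite ?ltnn // lt_kn IHn.
exists B => -[|n]; first exact: bernoulli_seq0.
rewrite bernoulli_seqS {2}/fps_egf {2}/B /nxt szp mulrC.
rewrite mulKf ?pnatr_eq0 -?lt0n ?fact_gt0 //.
rewrite (eq_bigr (fun k : 'I_n => fps_egf (nth 0 (pre n)) k / ((n.+1 - k)`!)%:R)).
  by rewrite addrC subrK /fps_X eqSS.
by move=> i _; rewrite /fps_egf nthp.
Qed.

(* Main.v *)
Require Import Defs.
From mathcomp Require Import all_boot all_order all_algebra all_solvable.
From mathcomp Require Import ring zify.

(** Why the congruence holds.  Put H_s for the sum of k^-s and S_n for the sum
    of k^n, both over 0 < k < p.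

    Since C(2p-1, p-1) is the product of the 1 + p/k and the product of the
    1 - p/k is 1 (p is odd), the binomial is the product of the 1 - p^2/k^2.
    Expanding and using Newton's identities, it is
    1 - p^2 H_2 + p^4 (H_2^2 - H_4)/2 modulo p^7 ([central_binomial_mod_p7]).
    A Wolstenholme prime has p^2 | H_2, so what remains is to express H_2
    modulo p^5 and H_4 modulo p^3 through Bernoulli numbers.

    The link is [power_sum_poly]: as long as n stays in one class -s modulo
    p - 1, S_n is n p G(p n) modulo p^5 for one cubic G with p-integral
    coefficients.  Indeed k = w (1 + p x) with w = k^(p^4), which is a
    (p-1)-st root of unity modulo p^5; so w^n only depends on the class of n,
    (1 + p x)^n is expanded by the binomial theorem, and the term free of n is
    the sum of the w^-s, which vanishes.  The exponent -s itself is
    p-adically close to p^4 (p-1) - s, so H_s is read off from the same cubic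
    ([inverse_sum_poly]).

    Faulhaber's formula turns S_n into p B_n + p^3 n(n-1)/6 B_(n-2) modulo p^5.
    Hence B_n/n, for n = t(p-1) - 2, is modulo p^4 a cubic polynomial in t
    whose value at t = 0 involves H_2.  A cubic f satisfies
    f(0) = 4f(1) - 6f(2) + 4f(3) - f(4), and this brings in the indices p-3,
    2p-4, 3p-5 and 4p-6.  In the same way B_m/m, for m = t(p-1) - 4, is linear
    in t modulo p^2, and f(0) = 2f(1) - f(2) brings in p-5 and 2p-6.  The
    result is [central_binomial_divided_bernoulli].

    It remains to pass from B_n/n to B_n.  With q = p/3, say,
    B_(p-3)/(p-3) is -B_(p-3)/3 times 1/(1-q), and the powers of p in the
    theorem come from cutting the geometric series after q^2.  The error has a
    factor p^6 B_n/n, and p divides B_n/n because p^2 divides H_2.  For the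
    indices p-5 and 2p-6 the corresponding error is p^6 times the difference of
    two quotients B_m/m, which agree modulo p. *)

Set Implicit Arguments.
Unset Strict Implicit.
Unset Printing Implicit Defensive.

Import Order.TTheory GRing.Theory Num.Theory.

Local Open Scope ring_scope.

(** * The ideals of the p-local integers *)

(** The ideal generated by p^e in the ring of rationals with denominator
    prime to p; [padic_ideal p 0] is that ring. *)
Definition padic_ideal (p e : nat) (x : rat) : Prop :=
  exists (m : int) (d : nat), coprime p d /\ x = p%:R ^+ e * m%:~R / d%:R.

Lemma coprime_natr_neq0 (p d : nat) : prime p -> coprime p d -> d%:R != 0 :> rat.
Proof.
move=> pp; rewrite pnatr_eq0; apply: contraTneq => ->.
by rewrite /coprime gcdn0; case: p pp => [|[]].
Qed.

Lemma padic_ideal0 (p e : nat) : padic_ideal p e 0.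
Proof. by exists 0, 1%N; split; [exact: coprimen1|rewrite mulr0 mul0r]. Qed.

Lemma padic_idealD (p e : nat) (x y : rat) : prime p ->
  padic_ideal p e x -> padic_ideal p e y -> padic_ideal p e (x + y).
Proof.
move=> pp [m [d [cd ->]]] [m' [d' [cd' ->]]].
exists (m * d'%:Z + m' * d%:Z), (d * d')%N; split; first by rewrite coprimeMr cd.
have d0 := coprime_natr_neq0 pp cd; have d'0 := coprime_natr_neq0 pp cd'.
by rewrite natrM rmorphD !rmorphM /=; field; rewrite d0 d'0.
Qed.

Lemma padic_idealM (p e f : nat) (x y : rat) : prime p ->
  padic_ideal p e x -> padic_ideal p f y -> padic_ideal p (e + f) (x * y).
Proof.
move=> pp [m [d [cd ->]]] [m' [d' [cd' ->]]].
exists (m * m'), (d * d')%N; split; first by rewrite coprimeMr cd.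
have d0 := coprime_natr_neq0 pp cd; have d'0 := coprime_natr_neq0 pp cd'.
by rewrite natrM exprD !rmorphM /=; field; rewrite d0 d'0.
Qed.

Lemma padic_idealN (p e : nat) (x : rat) :
  padic_ideal p e x -> padic_ideal p e (- x).
Proof.
by move=> [m [d [cd ->]]]; exists (- m), d; split; rewrite // rmorphN mulrN mulNr.
Qed.

Lemma padic_idealB (p e : nat) (x y : rat) : prime p ->
  padic_ideal p e x -> padic_ideal p e y -> padic_ideal p e (x - y).
Proof. by move=> pp hx hy; apply/padic_idealD/padic_idealN. Qed.

Lemma padic_ideal_le (p e f : nat) (x : rat) :
  (f <= e)%N -> padic_ideal p e x -> padic_ideal p f x.
Proof.
move=> le_fe [m [d [cd ->]]]; exists (p%:Z ^+ (e - f) * m), d; split=> //.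
by rewrite rmorphM rmorphXn /= mulrA -exprD subnKC.
Qed.

Lemma padic_int_nat (p n : nat) : padic_ideal p 0 n%:R.
Proof. by exists n%:Z, 1%N; split; [exact: coprimen1|rewrite divr1 mul1r]. Qed.

Lemma padic_ideal_natX (p e : nat) : padic_ideal p e (p%:R ^+ e).
Proof. by exists 1, 1%N; split; [exact: coprimen1|rewrite divr1 mulr1]. Qed.

Lemma padic_ideal_exp (p e : nat) (x : rat) : prime p ->
  padic_ideal p 0 x -> padic_ideal p e (p%:R ^+ e * x).
Proof.
by move=> pp hx; rewrite -[e in padic_ideal _ e]addn0; apply/padic_idealM/hx/padic_ideal_natX.
Qed.

Lemma padic_idealMl (p e : nat) (x y : rat) : prime p ->
  padic_ideal p 0 x -> padic_ideal p e y -> padic_ideal p e (x * y).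
Proof. by move=> pp; apply: padic_idealM. Qed.

Lemma padic_idealMr (p e : nat) (x y : rat) : prime p ->
  padic_ideal p e x -> padic_ideal p 0 y -> padic_ideal p e (x * y).
Proof. by move=> pp hx hy; rewrite mulrC; apply: padic_idealMl. Qed.

Lemma padic_idealX (p : nat) (x : rat) n : prime p ->
  padic_ideal p 0 x -> padic_ideal p 0 (x ^+ n).
Proof.
move=> pp hx; elim: n => [|n IHn]; first exact: (padic_int_nat p 1).
by rewrite exprS; apply: padic_idealMl.
Qed.

Lemma padic_ideal_sum (p e : nat) (I : Type) (r : seq I) (P : pred I) (F : I -> rat) :
  prime p -> (forall i, P i -> padic_ideal p e (F i)) ->
  padic_ideal p e (\sum_(i <- r | P i) F i).
Proof.
move=> pp hF; elim/big_ind: _ => //; first exact: padic_ideal0.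
by move=> x y; apply: padic_idealD.
Qed.

Lemma padic_idealP (p e : nat) (x : rat) : prime p ->
  padic_ideal p e x <-> exists2 y, padic_ideal p 0 y & x = p%:R ^+ e * y.
Proof.
move=> pp; split=> [[m [d [cd ->]]]|[y hy ->]]; last exact: padic_ideal_exp.
by exists (m%:~R / d%:R); [exists m, d; rewrite mul1r|rewrite mulrA].
Qed.

Lemma padic_ideal_nat (p e n : nat) : (p ^ e %| n)%N -> padic_ideal p e n%:R.
Proof.
move=> /dvdnP[m ->]; exists m%:Z, 1%N; split; first exact: coprimen1.
by rewrite divr1 natrM natrX mulrC.
Qed.

Lemma padic_ideal_natB (p e m n : nat) :
  m = n %[mod p ^ e] -> padic_ideal p e (m%:R - n%:R).
Proof.
wlog le_nm : m n / (n <= m)%N => [hw emn|/eqP].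
  case/orP: (leq_total n m) => le; first exact: hw.
  by rewrite -opprB; apply/padic_idealN/hw.
by rewrite eqn_mod_dvd // -natrB //; apply: padic_ideal_nat.
Qed.

Lemma padic_int_invn (p n : nat) : coprime p n -> padic_ideal p 0 (n%:R)^-1.
Proof. by move=> cpn; exists 1, n; split; rewrite // !mul1r. Qed.

Definition padic_unit (p : nat) (x : rat) : Prop :=
  [/\ x != 0, padic_ideal p 0 x & padic_ideal p 0 x^-1].

Lemma padic_unit_nat (p n : nat) : prime p -> coprime p n -> padic_unit p n%:R.
Proof.
move=> pp cpn; split; [|exact: padic_int_nat|exact: padic_int_invn].
exact: coprime_natr_neq0 cpn.
Qed.

Lemma padic_unitX (p : nat) (x : rat) n : prime p -> padic_unit p x -> padic_unit p (x ^+ n).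
Proof.
by move=> pp [x0 hx hx']; split; rewrite ?expf_neq0 -?exprVn //; apply: padic_idealX.
Qed.

Lemma padic_ideal_unit (p e : nat) (u x : rat) : prime p -> padic_unit p u ->
  padic_ideal p e (u * x) -> padic_ideal p e x.
Proof.
by move=> pp [u0 _ hu] hux; rewrite -(mulKf u0 x); apply: padic_idealMl.
Qed.

Lemma padic_ideal_inv (p e : nat) (x y : rat) : prime p -> padic_unit p x -> padic_unit p y ->
  padic_ideal p e (x - y) -> padic_ideal p e (x^-1 - y^-1).
Proof.
move=> pp [x0 hx hx'] [y0 hy hy'] hxy.
have -> : x^-1 - y^-1 = - (x^-1 * y^-1) * (x - y) by field; rewrite x0 y0.
by apply: padic_idealMl => //; apply/padic_idealN/padic_idealMl.
Qed.

Lemma padic_ideal_expB (p e : nat) (x y : rat) n : prime p ->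
  padic_ideal p 0 x -> padic_ideal p 0 y ->
  padic_ideal p e (x - y) -> padic_ideal p e (x ^+ n - y ^+ n).
Proof.
move=> pp hx hy hxy; rewrite subrXX; apply: padic_idealMr => //.
by apply: padic_ideal_sum => // i _; apply: padic_idealMl => //; apply: padic_idealX.
Qed.

(** The cofactor of x - y in x^p - y^p is a sum of p terms, all congruent to
    y^(p-1) modulo p, so it is itself divisible by p. *)
Lemma padic_ideal_expp (p e : nat) (x y : rat) : prime p -> (0 < e)%N ->
  padic_ideal p 0 x -> padic_ideal p 0 y ->
  padic_ideal p e (x - y) -> padic_ideal p e.+1 (x ^+ p - y ^+ p).
Proof.
move=> pp e0 hx hy hxy; rewrite subrXX -addn1; apply: padic_idealM => //.
have -> : \sum_(i < p) x ^+ (p.-1 - i) * y ^+ i =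
  \sum_(i < p) (x ^+ (p.-1 - i) - y ^+ (p.-1 - i)) * y ^+ i + p%:R * y ^+ p.-1.
  rewrite (mulr_natl (y ^+ _)) -[X in _ *+ X]card_ord -sumr_const -big_split /=.
  apply: eq_bigr => i _; rewrite mulrBl -exprD subnK ?subrK //.
  by rewrite -ltnS prednK ?prime_gt0.
apply: padic_idealD => //; last first.
  by rewrite -[p%:R]expr1; apply/padic_ideal_exp/padic_idealX.
apply: padic_ideal_sum => // i _; apply: padic_idealMr => //; last exact: padic_idealX.
by apply: padic_ideal_expB => //; apply: padic_ideal_le hxy.
Qed.

Lemma padic_ideal_exppX (p e : nat) (x y : rat) : prime p ->
  padic_ideal p 0 x -> padic_ideal p 0 y ->
  padic_ideal p 1 (x - y) -> padic_ideal p e.+1 (x ^+ (p ^ e) - y ^+ (p ^ e)).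
Proof.
move=> pp hx hy hxy; elim: e => [|e IHe]; first by rewrite expn0 !expr1.
by rewrite expnSr !exprM; apply: padic_ideal_expp => //; apply: padic_idealX.
Qed.

Lemma padic_ideal_divX (p k e : nat) (x : rat) : prime p ->
  padic_ideal p (k + e) (p%:R ^+ k * x) -> padic_ideal p e x.
Proof.
move=> pp /(padic_idealP _ _ pp)[y hy]; rewrite exprD -mulrA => /mulfI ->.
  exact: padic_ideal_exp.
by rewrite expf_neq0 // pnatr_eq0 -lt0n prime_gt0.
Qed.

Lemma padic_ideal_div_unit (p e : nat) (u x y : rat) : prime p -> padic_unit p u ->
  padic_ideal p e (x - u * y) -> padic_ideal p e (x / u - y).
Proof.
move=> pp [u0 hu hu'] hxy; rewrite (_ : _ - _ = u^-1 * (x - u * y)); last by field.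
exact: padic_idealMl.
Qed.

(** Every constant in the computation has its prime factors among 2, 3, 5
    and 7, which the computable side condition verifies. *)
Lemma coprime_smooth (p n : nat) : prime p -> (10 < p)%N -> (0 < n)%N ->
  all (leq^~ 10%N) (primes n) -> coprime p n.
Proof.
move=> pp p10 n0 /allP small; rewrite prime_coprime //; apply: contraL p10 => pn.
by rewrite -leqNgt small // mem_primes pp n0.
Qed.

Lemma padic_int_invn_smooth (p n : nat) : prime p -> (10 < p)%N -> (0 < n)%N ->
  all (leq^~ 10%N) (primes n) -> padic_ideal p 0 n%:R^-1.
Proof. by move=> pp p10 n0 small; apply/padic_int_invn/coprime_smooth. Qed.

Lemma padic_int1 (p : nat) : padic_ideal p 0 1.
Proof. exact: (padic_int_nat p 1). Qed.

Ltac padic_int :=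
  repeat match goal with
  | |- padic_ideal _ 0 (_ + _) => apply: padic_idealD
  | |- padic_ideal _ 0 (- _) => apply: padic_idealN
  | |- padic_ideal _ 0 (_ * _) => apply: padic_idealMl
  | |- padic_ideal _ 0 (_ ^+ _) => apply: padic_idealX
  | |- padic_ideal _ 0 1 => apply: padic_int1
  | |- padic_ideal _ 0 (_%:R) => apply: padic_int_nat
  | |- padic_ideal _ 0 (_%:R^-1) => apply: padic_int_invn_smooth
  | |- padic_ideal _ _ _ => assumption
  | |- _ => done
  end.

(** The power of p dividing i+1 is at most i+1, hence less than p^(i-e+1) when
    p > 10 and e <= 5.  This bounds the tail of Faulhaber's formula. *)
Lemma padic_ideal_expn_divS (p e i : nat) : prime p -> (10 < p)%N -> (e <= 5)%N ->
  (e <= i)%N -> padic_ideal p e (p%:R ^+ i / i.+1%:R).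
Proof.
move=> pp p10 e5 le_ei.
have [m co_pm iE] := pfactor_coprime pp (ltn0Sn i).
set v := logn p i.+1 in iE.
have lt_v : (v <= i - e)%N.
  rewrite -ltnS -(ltn_exp2l _ _ (prime_gt1 pp)).
  apply: (@leq_ltn_trans i.+1).
    by rewrite iE leq_pmull // lt0n; apply: contraTneq co_pm => ->; rewrite /coprime gcdn0 gtn_eqF ?prime_gt1.
  apply: (@leq_trans (11 ^ (i - e).+1)); last by rewrite leq_exp2r.
  rewrite -{1}(subnKC le_ei); elim: (i - e)%N => [|d IHd]; first lia.
  rewrite expnS; lia.
have p0 : p%:R != 0 :> rat by rewrite pnatr_eq0 -lt0n prime_gt0.
have m0 := coprime_natr_neq0 pp co_pm.
have -> : p%:R ^+ i / i.+1%:R = p%:R ^+ e * (p%:R ^+ (i - v - e) / m%:R) :> rat.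
  rewrite iE natrM natrX -{1}(subnK (_ : v <= i)%N) ?exprD; last lia.
  rewrite -{1}(subnKC (_ : e <= i - v)%N) ?exprD; last lia.
  by field; rewrite m0 expf_neq0.
by apply: padic_ideal_exp => //; apply: padic_idealMl; rewrite //; [exact/padic_idealX/padic_int_nat|exact: padic_int_invn].
Qed.

Lemma ratcong_padic (p e : nat) (a b : rat) : prime p ->
  padic_ideal p e (a - b) -> ratcong p e a b.
Proof.
rewrite /ratcong; set x := a - b => pp [m [d [cd xE]]].
have d0 : d%:R != 0 :> rat := coprime_natr_neq0 pp cd.
have cpd : coprimez p%:Z d%:Z by [].
have eqz : numq x * d%:Z = p%:Z ^+ e * m * denq x.
  apply: (@intr_inj rat); rewrite !rmorphM rmorphXn /= numqE mulrAC.
  by congr (_ * _); rewrite xE divfK.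
have cqd : (denq x %| d%:Z)%Z.
  rewrite -(@Gauss_dvdzr _ (numq x)); first by rewrite eqz dvdz_mull.
  by rewrite /coprimez gcdzC; apply: (coprime_num_den x).
apply/andP; split; last by apply: coprimez_dvdr cpd.
rewrite -(@Gauss_dvdzl _ _ d%:Z); first by rewrite eqz -mulrA dvdz_mulr.
by rewrite coprimezXl.
Qed.

(** * Bernoulli numbers and power sums *)

Lemma binomial_ratE (m k : nat) : (k <= m)%N ->
  'C(m, k)%:R = m`!%:R / (k`!%:R * (m - k)`!%:R) :> rat.
Proof.
move=> le_km; rewrite -(bin_fact le_km) !natrM mulfK //.
by rewrite -natrM pnatr_eq0 -lt0n muln_gt0 !fact_gt0.
Qed.

Lemma bernoulli_seq_recurrenceP (B : nat -> rat) :
  bernoulli_seq B <->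
  (forall m, \sum_(j < m) 'C(m, j)%:R * B j = (m == 1%N)%:R).
Proof.
have f0 i : i`!%:R != 0 :> rat by rewrite pnatr_eq0 -lt0n fact_gt0.
have scaled n : \sum_(j < n.+1) 'C(n.+1, j)%:R * B j =
    n.+1`!%:R * fps_mul (fps_egf B) fps_expm1 n.+1.
  rewrite bernoulli_seqS.
  have -> : fps_egf B n = fps_egf B n / (n.+1 - n)`!%:R by rewrite subSnn divr1.
  rewrite -(big_ord_recr n (fun k => fps_egf B k / (n.+1 - k)`!%:R)) /= mulr_sumr.
  apply: eq_bigr => j _; rewrite binomial_ratE 1?ltnW // /fps_egf.
  by field; rewrite !f0.
have scaledX n : n.+1`!%:R * fps_X n.+1 = (n.+1 == 1%N)%:R.
  by rewrite /fps_X; case: n => [|n]; rewrite ?mulr1 ?mulr0.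
split=> [hB [|n]|hB [|n]]; first by rewrite big_ord0.
- by rewrite scaled hB scaledX.
- exact: bernoulli_seq0.
by apply: (mulfI (f0 n.+1)); rewrite -scaled hB scaledX.
Qed.

(** Up to the factor n+1, the polynomial with coefficients C(n+1, j) B_j is an
    antidifference of x^n: expand (x+1)^(n+1-j), collect the power x^i, and its
    coefficient is the Bernoulli recurrence of order n+1-i, which vanishes
    except for i = n. *)
Lemma bernoulli_antidifference (B : nat -> rat) (n : nat) (x : rat) : bernoulli_seq B ->
  \sum_(j < n.+1) 'C(n.+1, j)%:R * B j * ((x + 1) ^+ (n.+1 - j) - x ^+ (n.+1 - j)) =
  n.+1%:R * x ^+ n.
Proof.
move=> /bernoulli_seq_recurrenceP hB.
transitivity (\sum_(j < n.+1) \sum_(i < n.+1 | (i + j < n.+1)%N)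
   'C(n.+1, i)%:R * x ^+ i * ('C(n.+1 - i, j)%:R * B j)).
  apply: eq_bigr => j _; rewrite [x + 1]addrC exprDn big_ord_recr /=.
  rewrite subnn expr0 mul1r binn mulr1n addrK mulr_sumr.
  rewrite (big_ord_widen_cond n.+1 xpredT
    (fun i => 'C(n.+1, j)%:R * B j * (1 ^+ (n.+1 - j - i) * x ^+ i *+ 'C(n.+1 - j, i)))); last exact: leq_subr.
  apply: eq_big => [i|i] /=; first by rewrite ltn_subRL addnC.
  rewrite ltn_subRL => lt_ji; have lt_i := ltn_ord i; have lt_j := ltn_ord j.
  rewrite expr1n mul1r -[x ^+ i *+ _]mulr_natr.
  rewrite binomial_ratE; last by lia.
  rewrite binomial_ratE; last by lia.
  rewrite binomial_ratE; last by lia.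
  rewrite binomial_ratE; last by lia.
  have -> : (n.+1 - j - i = n.+1 - i - j)%N by lia.
  have f0 k : k`!%:R != 0 :> rat by rewrite pnatr_eq0 -lt0n fact_gt0.
  by field; rewrite !f0.
rewrite (exchange_big_dep xpredT) //= big_ord_recr /= big1 => [|i _].
  rewrite add0r (big_pred1 ord0) => [|j /=]; last by rewrite -ltn_subRL subSnn ltnS leqn0.
  have B0 : B 0%N = 1 by have := hB 1%N; rewrite big_ord1 bin0 mul1r.
  by rewrite /= B0 bin0 binSn !mulr1.
rewrite -mulr_sumr.
have := hB (n.+1 - i)%N.
have -> : (n.+1 - i == 1)%N = false by have := ltn_ord i; lia.
rewrite (big_ord_widen n.+1 (fun j => 'C(n.+1 - i, j)%:R * B j)) ?leq_subr //.
rewrite (eq_bigl (fun j : 'I_n.+1 => (i + j < n.+1)%N)) => [->|j]; first by rewrite mulr0.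
by rewrite ltn_subRL.
Qed.

Lemma faulhaber (B : nat -> rat) (n p : nat) : bernoulli_seq B ->
  n.+1%:R * \sum_(k < p) k%:R ^+ n =
  \sum_(j < n.+1) 'C(n.+1, j)%:R * B j * p%:R ^+ (n.+1 - j).
Proof.
move=> hB; elim: p => [|p IHp].
  rewrite big_ord0 mulr0 big1 // => j _.
  by rewrite subSn ?expr0n ?mulr0 // -ltnS.
rewrite big_ord_recr mulrDr {}IHp /= -(bernoulli_antidifference n _ hB) -big_split /=.
by apply: eq_bigr => j _; rewrite -mulrDr addrC subrK -natr1.
Qed.

(** The antidifference identity at x = -1 is a recurrence for (-1)^j B_j.  It
    shows that (-1)^j B_j - [j = 1] satisfies the recurrence of B_j, hence
    equals B_j. *)
Lemma bernoulli_odd (B : nat -> rat) (n : nat) : bernoulli_seq B ->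
  odd n -> (1 < n)%N -> B n = 0.
Proof.
move=> hB odd_n n1.
pose B' j := (-1) ^+ j * B j - (j == 1%N)%:R.
have hB' : bernoulli_seq B'.
  apply/bernoulli_seq_recurrenceP => -[|m]; first by rewrite big_ord0.
  have alt : \sum_(j < m.+1) 'C(m.+1, j)%:R * ((-1) ^+ j * B j) = m.+1%:R.
    have /(congr1 (fun x => (-1) ^+ m * x)) := bernoulli_antidifference m (-1) hB.
    rewrite mulrCA -exprD addnn -mul2n exprM sqrrN !expr1n mulr1 => <-.
    rewrite mulr_sumr; apply: eq_bigr => j _.
    have lt_jm := ltn_ord j.
    rewrite addNr expr0n subn_eq0 leqNgt lt_jm /= sub0r.
    have -> : (-1) ^+ j = (-1) ^+ m * (-1) * (-1) ^+ (m.+1 - j) :> rat.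
      rewrite -exprSr -exprD -[RHS]signr_odd -[LHS]signr_odd; congr (_ ^+ nat_of_bool _).
      by rewrite oddD oddB ?(ltnW lt_jm) // addbA addbb.
    ring.
  rewrite /B'; under eq_bigr => j _ do rewrite mulrBr.
  rewrite sumrB alt; case: m {alt} => [|m].
    by rewrite big_ord1 mulr0 subr0.
  rewrite (bigD1 (lift ord0 ord0)) //= bin1 mulr1 big1 ?addr0 ?subrr // => j /eqP ne_j1.
  case: eqP => [j1|]; last by rewrite mulr0.
  by case: ne_j1; apply: val_inj.
have := bernoulli_seq_unique hB hB' n; rewrite /B' -signr_odd odd_n expr1 mulN1r.
rewrite gtn_eqF // subr0 => /eqP.
by rewrite -addr_eq0 -mulr2n mulrn_eq0 => /eqP.
Qed.

(** * Power sums as p-adic polynomials in the exponent *)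

Definition power_sum (p n : nat) : rat := \sum_(1 <= k < p) k%:R ^+ n.

(** Doubling permutes the nonzero residues modulo an odd prime. *)
Lemma sum_double_mod (p : nat) (f : nat -> rat) : prime p -> (2 < p)%N ->
  \sum_(1 <= k < p) f ((2 * k) %% p)%N = \sum_(1 <= k < p) f k.
Proof.
move=> pp p2; rewrite -(big_map (fun k => (2 * k) %% p)%N xpredT f).
have co2 : coprime p 2 by rewrite prime_coprime // gtnNdvd.
have uniq2 : uniq [seq ((2 * k) %% p)%N | k <- index_iota 1 p].
  rewrite map_inj_in_uniq ?iota_uniq // => j k.
  rewrite !mem_index_iota => /andP[_ jp] /andP[_ kp] /eqP.
  wlog le_jk : j k jp kp / (j <= k)%N => [hw ejk|].
    by case/orP: (leq_total j k) => le; [exact: hw|apply/esym/hw => //; rewrite eq_sym].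
  rewrite eq_sym eqn_mod_dvd ?leq_mul2l // -mulnBr Gauss_dvdr // => dvd.
  have := leq_ltn_trans (leq_subr j k) kp.
  by case: (posnP (k - j)) => [?|k_j]; [lia|rewrite ltnNge dvdn_leq].
have sub2 : {subset [seq ((2 * k) %% p)%N | k <- index_iota 1 p] <= index_iota 1 p}.
  move=> i /mapP[k hk ->]; move: hk; rewrite !mem_index_iota => /andP[k0 kp].
  apply/andP; split; last by rewrite ltn_pmod ?prime_gt0.
  rewrite lt0n -/(dvdn p _) Gauss_dvdr //.
  by rewrite gtnNdvd.
apply: perm_big; apply: uniq_perm => //; first exact: iota_uniq.
by have [] := uniq_min_size uniq2 sub2; rewrite ?size_map.
Qed.

Lemma padic_unit_small (p k : nat) : prime p -> k \in index_iota 1 p -> padic_unit p k%:R.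
Proof.
rewrite mem_index_iota => pp /andP[k0 kp]; apply: padic_unit_nat => //.
by rewrite prime_coprime // gtnNdvd.
Qed.

(** Modulo p^(e+1), k^(p^e) depends only on k modulo p.  Replacing k by
    2k mod p therefore multiplies the sum by a^-1, where a = 2^(p^e s), and a - 1
    is a unit because it is congruent to 2^s - 1 modulo p. *)
Lemma teichmuller_sum (p s e : nat) : prime p -> (2 < p)%N -> coprime p (2 ^ s - 1) ->
  padic_ideal p e.+1 (\sum_(1 <= k < p) ((k%:R ^+ (p ^ e)) ^+ s)^-1).
Proof.
move=> pp p2 co_s; set f := fun k : nat => ((k%:R ^+ (p ^ e)) ^+ s)^-1 : rat.
rewrite -/(\sum_(1 <= k < p) f k); set W := \sum_(_ <= _ < _) _.
set a : rat := (2%:R ^+ (p ^ e)) ^+ s.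
have ua : padic_unit p a.
  by do 2!apply: padic_unitX => //; apply: padic_unit_nat => //; rewrite prime_coprime // gtnNdvd.
have ua1 : padic_unit p (a - 1).
  rewrite /a -!natrX -(@natrB _ _ 1) ?expn_gt0 //; apply: padic_unit_nat => //.
  rewrite prime_coprime // -eqn_mod_dvd ?expn_gt0 //.
  rewrite (_ : (2 ^ p ^ e) ^ s = 2 ^ s %[mod p])%N.
    by rewrite eqn_mod_dvd ?expn_gt0 // -prime_coprime.
  rewrite -modnXm -[in RHS]modnXm; congr (_ ^ _ %% _)%N.
  by elim: (e) => // i IHi; rewrite expnSr expnM -modnXm IHi modnXm fermat_little.
apply: (padic_ideal_unit pp ua1).
have -> : (a - 1) * W = a * (W - a^-1 * W).
  by case: ua => a0 _ _; field.
case: (ua) => _ aint aint'; apply: padic_idealMl => //.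
rewrite {1}/W -(sum_double_mod f pp p2) mulr_sumr -sumrB big_seq.
apply: padic_ideal_sum => // k hk; rewrite /f /a -invfM -!exprMn -natrM.
have co2k : coprime p (2 * k).
  rewrite coprimeMr prime_coprime // gtnNdvd //= prime_coprime //.
  by move: hk; rewrite mem_index_iota => /andP[k0 kp]; rewrite gtnNdvd.
apply: padic_ideal_inv => //.
- by do 2!apply: padic_unitX => //; apply: padic_unit_nat; rewrite ?coprime_modr.
- by do 2!apply: padic_unitX => //; apply: padic_unit_nat.
apply: padic_ideal_expB; [by []|by padic_int|by padic_int|].
apply: padic_ideal_exppX; [by []|by padic_int|by padic_int|].
by apply: padic_ideal_natB; rewrite expn1 modn_mod.
Qed.

(** The binomial coefficients are written as polynomials in n, because it is
    the dependence on n that matters in [power_sum_poly]. *)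
Lemma binomial_expansion5 (p n : nat) (y : rat) : prime p -> (10 < p)%N ->
  padic_ideal p 0 y -> exists2 r, padic_ideal p 0 r &
  (1 + y) ^+ n = 1 + n%:R * y + n%:R * (n%:R - 1) / 2 * y ^+ 2
   + n%:R * (n%:R - 1) * (n%:R - 2) / 6 * y ^+ 3
   + n%:R * (n%:R - 1) * (n%:R - 2) * (n%:R - 3) / 24 * y ^+ 4 + y ^+ 5 * r.
Proof.
move=> pp p10 hy; elim: n => [|n [r hr IHn]].
  by exists 0; [exact: padic_ideal0|field].
exists (r * (1 + y) + n%:R * (n%:R - 1) * (n%:R - 2) * (n%:R - 3) / 24).
  by padic_int.
by rewrite exprSr IHn -natr1; field.
Qed.

Lemma fermat_padic (p k : nat) : prime p -> k \in index_iota 1 p ->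
  padic_ideal p 1 (k%:R ^+ p.-1 - 1).
Proof.
move=> pp hk; rewrite -natrX; apply: (padic_ideal_natB (n := 1)).
rewrite expn1 -(totient_prime pp); apply: Euler_exp_totient.
move: hk; rewrite mem_index_iota => /andP[k0 kp].
by rewrite coprime_sym prime_coprime // gtnNdvd.
Qed.

Lemma fermat_padicX (p k e n : nat) : prime p -> k \in index_iota 1 p ->
  (p.-1 %| n)%N -> padic_ideal p e.+1 ((k%:R ^+ (p ^ e)) ^+ n - 1).
Proof.
move=> pp hk /dvdnP[t ->]; rewrite mulnC -exprM mulnCA !exprM.
have int_kp : padic_ideal p 0 (k%:R ^+ p.-1) by padic_int.
have := padic_ideal_exppX e pp int_kp (padic_int1 p) (fermat_padic pp hk).
rewrite expr1n => /(padic_ideal_expB t pp); rewrite expr1n.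
by apply; [exact: padic_idealX|exact: padic_int1].
Qed.

Definition cubic (g0 g1 g2 g3 z : rat) : rat := g0 + g1 * z + g2 * z ^+ 2 + g3 * z ^+ 3.

(** With k = w_k (1 + p x_k) and w_k = k^(p^4), the power k^n is congruent to
    w_k^-s (1 + p x_k)^n for n in the class -s.  Each binomial coefficient C(n, j) with j > 0 is n
    times a polynomial in n, and the term j = 0 is [teichmuller_sum].  The
    coefficients g_i collect the powers of n. *)
Lemma power_sum_poly (p s : nat) :
  prime p -> (10 < p)%N -> coprime p (2 ^ s - 1) ->
  exists g0 g1 g2 g3 : rat,
  [/\ padic_ideal p 0 g0, padic_ideal p 0 g1, padic_ideal p 0 g2, padic_ideal p 0 g3
    & forall n, (p.-1 %| n + s)%N ->
      padic_ideal p 5 (power_sum p n - n%:R * p%:R * cubic g0 g1 g2 g3 (p%:R * n%:R))].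
Proof.
move=> pp p10 co_s.
have p0 : p%:R != 0 :> rat by rewrite pnatr_eq0 -lt0n prime_gt0.
pose w (k : nat) : rat := k%:R ^+ (p ^ 4); pose x k := (k%:R / w k - 1) / p%:R.
have uw k : k \in index_iota 1 p -> padic_unit p (w k).
  by move=> hk; apply/padic_unitX/padic_unit_small.
have x_int k : k \in index_iota 1 p -> padic_ideal p 0 (x k).
  move=> hk; case: (uw k hk) => w0 _ hw'.
  have /(padic_idealP _ _ pp)[y hy ky] : padic_ideal p 1 (k%:R - w k).
    rewrite /w -natrX; apply: padic_ideal_natB; rewrite expn1.
    by elim: 4%N => // i IHi; rewrite expnSr expnM fermat_little.
  have -> : x k = y / w k; last exact: padic_idealMl.
  by rewrite /x -{1}(subrK (w k) k%:R) ky; field; rewrite w0 p0.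
have kE k : k \in index_iota 1 p -> k%:R = w k * (1 + p%:R * x k).
  by move=> hk; case: (uw k hk) => w0 _ _; rewrite /x; field; rewrite w0 p0.
pose X j : rat := \sum_(1 <= k < p) (w k ^+ s)^-1 * x k ^+ j.
have X_int j : padic_ideal p 0 (X j).
  rewrite /X big_seq; apply: padic_ideal_sum => // k hk; apply: padic_idealMl => //.
    by case: (padic_unitX s pp (uw k hk)).
  by apply/padic_idealX/x_int.
(* These combinations collect the coefficients of n, n^2, n^3, n^4 in the sum
   of the C(n, j) p^j X j, with the matching powers of p taken out. *)
exists (X 1%N - p%:R * X 2 / 2 + p%:R ^+ 2 * X 3 / 3 - p%:R ^+ 3 * X 4 / 4),
  (X 2 / 2 - p%:R * X 3 / 2 + 11 / 24 * p%:R ^+ 2 * X 4),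
  (X 3 / 6 - p%:R * X 4 / 4), (X 4 / 24).
split; [by padic_int|by padic_int|by padic_int|by padic_int|] => n dvd_n.
pose T k : rat := 1 + n%:R * (p%:R * x k) + n%:R * (n%:R - 1) / 2 * (p%:R * x k) ^+ 2
   + n%:R * (n%:R - 1) * (n%:R - 2) / 6 * (p%:R * x k) ^+ 3
   + n%:R * (n%:R - 1) * (n%:R - 2) * (n%:R - 3) / 24 * (p%:R * x k) ^+ 4.
have approx : padic_ideal p 5
    (\sum_(1 <= k < p) (k%:R ^+ n - (w k ^+ s)^-1 * T k)).
  rewrite big_seq; apply: padic_ideal_sum => // k hk.
  have hx := x_int k hk; have [ws0 hws hws'] := padic_unitX s pp (uw k hk).
  have [w0 hw _] := uw k hk.
  have hT : padic_ideal p 0 (T k) by rewrite /T; padic_int.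
  have [r hr exp5] := @binomial_expansion5 p n (p%:R * x k) pp p10 ltac:(by padic_int).
  have -> : k%:R ^+ n - (w k ^+ s)^-1 * T k =
      (w k ^+ s)^-1 * (w k ^+ (n + s) - 1) * T k + p%:R ^+ 5 * (w k ^+ n * x k ^+ 5 * r).
    rewrite {1}(kE k hk) exprMn exp5 -/(T k) exprD; by field.
  apply: padic_idealD; [by []| |by apply: padic_ideal_exp; padic_int].
  apply: padic_idealMr => //; apply: padic_idealMl => //.
  exact: fermat_padicX.
(* X 0 is the part of the sum that does not depend on n. *)
have W0 : padic_ideal p 5 (X 0).
  rewrite /X; under eq_bigr do rewrite expr0 mulr1.
  exact: teichmuller_sum (ltn_trans _ p10) co_s.
rewrite (_ : _ - _ = \sum_(1 <= k < p) (k%:R ^+ n - (w k ^+ s)^-1 * T k) + X 0).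
  exact: padic_idealD.
have -> : \sum_(1 <= k < p) (k%:R ^+ n - (w k ^+ s)^-1 * T k) =
  power_sum p n - (X 0 + n%:R * p%:R * X 1 + n%:R * (n%:R - 1) / 2 * p%:R ^+ 2 * X 2
   + n%:R * (n%:R - 1) * (n%:R - 2) / 6 * p%:R ^+ 3 * X 3
   + n%:R * (n%:R - 1) * (n%:R - 2) * (n%:R - 3) / 24 * p%:R ^+ 4 * X 4).
  rewrite sumrB; congr (_ - _); rewrite /X !mulr_sumr -!big_split /=.
  by apply: eq_bigr => k _; rewrite /T; ring.
by rewrite /cubic; field.
Qed.

(** * Inverse power sums *)

Definition inverse_sum (p s : nat) : rat := \sum_(1 <= k < p) (k%:R ^+ s)^-1.

(** By Euler's theorem, k^-s is k^(p^e (p-1) - s) modulo p^(e+1). *)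
Lemma inverse_power_sum (p s e : nat) : prime p -> (2 < p)%N -> (s <= p ^ e * p.-1)%N ->
  padic_ideal p e.+1
   (inverse_sum p s - power_sum p (p ^ e * p.-1 - s)).
Proof.
move=> pp p2 le_s; rewrite /inverse_sum /power_sum -sumrB big_seq; apply: padic_ideal_sum => // k hk.
have [ks0 _ hks'] := padic_unitX s pp (padic_unit_small pp hk).
have -> : (k%:R ^+ s)^-1 - k%:R ^+ (p ^ e * p.-1 - s) =
   - ((k%:R ^+ s)^-1 * ((k%:R ^+ (p ^ e)) ^+ p.-1 - 1)) :> rat.
  by rewrite -exprM -[in RHS](subnK le_s) exprD; field.
by apply/padic_idealN/padic_idealMl => //; apply: fermat_padicX.
Qed.

(** The exponent N = p^4 (p-1) - s represents -s both modulo p - 1, as needed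
    for the class, and modulo p^4, as needed for the polynomial. *)
Lemma inverse_sum_poly (p s : nat) (g0 g1 g2 g3 : rat) :
  prime p -> (2 < p)%N -> (s <= p)%N ->
  padic_ideal p 0 g0 -> padic_ideal p 0 g1 -> padic_ideal p 0 g2 -> padic_ideal p 0 g3 ->
  (forall n, (p.-1 %| n + s)%N ->
     padic_ideal p 5 (power_sum p n - n%:R * p%:R * cubic g0 g1 g2 g3 (p%:R * n%:R))) ->
  padic_ideal p 5 (inverse_sum p s + s%:R * p%:R * cubic g0 g1 g2 g3 (- (p%:R * s%:R))).
Proof.
move=> pp p2 le_sp h0 h1 h2 h3 hS.
have le_s : (s <= p ^ 4 * p.-1)%N.
  apply: leq_trans le_sp _; rewrite -(prednK (prime_gt0 pp)) /=.
  by rewrite expnS -mulnA leq_pmulr // muln_gt0 expn_gt0 /=; lia.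
set N := (p ^ 4 * p.-1 - s)%N.
have /hS hN : (p.-1 %| N + s)%N by rewrite subnK // dvdn_mull.
have hH : padic_ideal p 5 (inverse_sum p s - power_sum p N) := inverse_power_sum pp p2 le_s.
have NE : N%:R = p%:R ^+ 4 * p.-1%:R - s%:R :> rat by rewrite natrB // natrM natrX.
set c : rat := p.-1%:R in NE; have hc : padic_ideal p 0 c by exact: padic_int_nat.
(* z G(p z) at z = N and z = -s differ by a multiple of N + s = p^4 c. *)
rewrite (_ : _ + _ = (inverse_sum p s - power_sum p N) +
  (power_sum p N - N%:R * p%:R * cubic g0 g1 g2 g3 (p%:R * N%:R)) +
  p%:R ^+ 5 * (c * (g0 + g1 * p%:R * (N%:R - s%:R)
    + g2 * p%:R ^+ 2 * (N%:R ^+ 2 - N%:R * s%:R + s%:R ^+ 2)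
    + g3 * p%:R ^+ 3 * (N%:R ^+ 3 - N%:R ^+ 2 * s%:R + N%:R * s%:R ^+ 2 - s%:R ^+ 3)))); last first.
  rewrite NE /cubic; ring.
apply: padic_idealD; [by []|exact: padic_idealD|apply: padic_ideal_exp => //].
by padic_int.
Qed.

(** * Bernoulli numbers modulo powers of p *)

(** Class information modulo p - 1 includes the parity. *)
Lemma even_of_dvd_predn (p n s : nat) : prime p -> (2 < p)%N -> ~~ odd s ->
  (p.-1 %| n + s)%N -> ~~ odd n.
Proof.
move=> pp p2 ev_s /dvdnP[t /(congr1 odd)]; rewrite oddM oddD (negbTE ev_s) addbF => ->.
have : odd p by case: (even_prime pp) => // pE; rewrite pE in p2.
by rewrite -(prednK (prime_gt0 pp)) /= => /negbTE ->; rewrite andbF.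
Qed.

(** Faulhaber's formula with the Bernoulli indices in decreasing order, so
    that the powers of p increase. *)
Lemma faulhaber_rev (B : nat -> rat) (p n : nat) : bernoulli_seq B -> (0 < n)%N ->
  power_sum p n =
  \sum_(0 <= i < n.+1) 'C(n, i)%:R * B (n - i)%N * (p%:R ^+ i.+1 / i.+1%:R).
Proof.
move=> hB n0; have n10 : n.+1%:R != 0 :> rat by rewrite pnatr_eq0.
have -> : power_sum p n = \sum_(k < p) k%:R ^+ n.
  rewrite -(big_mkord xpredT (fun k => k%:R ^+ n)) /power_sum.
  case: p => [|p]; first by rewrite !big_geq.
  by rewrite [RHS]big_ltn // expr0n gtn_eqF // add0r.
apply: (mulfI n10); rewrite (faulhaber n p hB) mulr_sumr.
rewrite -(big_mkord xpredT (fun j => 'C(n.+1, j)%:R * B j * p%:R ^+ (n.+1 - j))).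
rewrite big_nat_rev /= !big_mkord; apply: eq_bigr => i _.
have le_in : (i <= n)%N by rewrite -ltnS.
have -> : (0 + n.+1 - i.+1 = n - i)%N by lia.
have -> : (n.+1 - (n - i) = i.+1)%N by lia.
rewrite !binomial_ratE //; last by lia.
have -> : (n.+1 - (n - i) = i.+1)%N by lia.
rewrite !factS !natrM.
have f0 k : k`!%:R != 0 :> rat by rewrite pnatr_eq0 -lt0n fact_gt0.
by field; rewrite !f0 /= !nat1r !pnatr_eq0.
Qed.

(** In Faulhaber's formula for S_n every term but p B_n contains p B_m with
    m < n and an integral factor p^i/(i+1), so induction applies. *)
Lemma padic_int_p_bernoulli (B : nat -> rat) (p n : nat) : bernoulli_seq B ->
  prime p -> (10 < p)%N -> padic_ideal p 0 (p%:R * B n).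
Proof.
move=> hB pp p10; elim/ltn_ind: n => -[_|n IHn].
  have := (bernoulli_seq_recurrenceP B).1 hB 1%N.
  by rewrite big_ord1 bin0 mul1r => ->; padic_int.
have := faulhaber_rev p hB (ltn0Sn n); rewrite big_ltn // subn0 bin0 mul1r => Sn.
have -> : p%:R * B n.+1 = power_sum p n.+1 - \sum_(1 <= i < n.+2)
   'C(n.+1, i)%:R * B (n.+1 - i)%N * (p%:R ^+ i.+1 / i.+1%:R).
  by rewrite Sn addrK divr1 expr1 mulrC.
apply: padic_idealB => //.
  by apply: padic_ideal_sum => // k _; padic_int.
rewrite big_nat; apply: padic_ideal_sum => // i /andP[i0 _].
have -> : 'C(n.+1, i)%:R * B (n.+1 - i)%N * (p%:R ^+ i.+1 / i.+1%:R) =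
  'C(n.+1, i)%:R * (p%:R * B (n.+1 - i)%N) * (p%:R ^+ i / i.+1%:R) by rewrite exprS; ring.
have int_i : padic_ideal p 0 (p%:R ^+ i / i.+1%:R) by apply: padic_ideal_expn_divS.
have int_B : padic_ideal p 0 (p%:R * B (n.+1 - i)%N) by apply: IHn; lia.
by apply: padic_idealMl => //; apply: padic_idealMl => //; apply: padic_int_nat.
Qed.

Lemma faulhaber_padic (B : nat -> rat) (p n e : nat) : bernoulli_seq B ->
  prime p -> (10 < p)%N -> (e <= 5)%N -> (0 < n)%N -> (e <= n)%N ->
  padic_ideal p e (power_sum p n -
    \sum_(0 <= i < e) 'C(n, i)%:R * B (n - i)%N * (p%:R ^+ i.+1 / i.+1%:R)).
Proof.
move=> hB pp p10 e5 n0 le_en; rewrite (faulhaber_rev p hB n0).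
rewrite (@big_cat_nat _ _ _ e) //=; last exact: leqW.
rewrite addrAC subrr add0r big_nat; apply: padic_ideal_sum => // i /andP[le_ei _].
have -> : 'C(n, i)%:R * B (n - i)%N * (p%:R ^+ i.+1 / i.+1%:R) =
  'C(n, i)%:R * (p%:R * B (n - i)%N) * (p%:R ^+ i / i.+1%:R) by rewrite exprS; ring.
apply: padic_idealMl => //; last exact: padic_ideal_expn_divS.
by apply: padic_idealMl => //; [exact: padic_int_nat|exact: padic_int_p_bernoulli].
Qed.

(** Modulo p, p B_n is S_n, and S_n is divisible by p in the class of n by
    [power_sum_poly]. *)
Lemma padic_int_bernoulli (B : nat -> rat) (p s n : nat) : bernoulli_seq B ->
  prime p -> (10 < p)%N -> coprime p (2 ^ s - 1) -> (0 < n)%N -> (p.-1 %| n + s)%N ->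
  padic_ideal p 0 (B n).
Proof.
move=> hB pp p10 co_s n0 dvd_n.
have := faulhaber_padic hB pp p10 (isT : 1 <= 5)%N n0 n0.
rewrite big_nat1 bin0 subn0 mul1r divr1 expr1 => fb.
have [g0 [g1 [g2 [g3 [h0 h1 h2 h3 /(_ n dvd_n) Sn]]]]] := power_sum_poly pp p10 co_s.
set G := cubic _ _ _ _ _ in Sn.
have intG : padic_ideal p 0 G by rewrite /G /cubic; padic_int.
have /(padic_idealP _ _ pp)[y hy pB] : padic_ideal p 1 (p%:R * B n).
  rewrite (_ : p%:R * B n = (power_sum p n - n%:R * p%:R * G) + p%:R ^+ 1 * (n%:R * G)
     - (power_sum p n - B n * p%:R)); last by rewrite expr1; ring.
  apply: padic_idealB => //; apply: padic_idealD => //; first exact: padic_ideal_le Sn.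
  by apply: padic_ideal_exp; padic_int.
rewrite (_ : B n = y) //; apply: mulfI pB.
by rewrite pnatr_eq0 -lt0n prime_gt0.
Qed.

(** The term with B_(n-1) vanishes by parity, and the one with B_(n-2) carries
    p^3. *)
Lemma faulhaber_mod_p3 (B : nat -> rat) (p n : nat) : bernoulli_seq B ->
  prime p -> (10 < p)%N -> ~~ odd n -> (2 < n)%N -> padic_ideal p 0 (B (n - 2)%N) ->
  padic_ideal p 3 (power_sum p n - p%:R * B n).
Proof.
move=> hB pp p10 ev_n n2 intB.
have := faulhaber_padic hB pp p10 (isT : 3 <= 5)%N (ltn_trans _ n2) n2.
rewrite !big_nat_recr //= big_geq // (bernoulli_odd hB (n := (n - 1)%N)); try lia.
rewrite subn0 bin0 => /(_ isT) h.
set x := (X in padic_ideal p 3 X) in h.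
rewrite (_ : _ - _ = x + p%:R ^+ 3 * ('C(n, 2)%:R * B (n - 2)%N / 3)); last by rewrite /x; field.
by apply: padic_idealD => //; apply: padic_ideal_exp => //; padic_int.
Qed.

Lemma faulhaber_mod_p5 (B : nat -> rat) (p n : nat) : bernoulli_seq B ->
  prime p -> (10 < p)%N -> ~~ odd n -> (4 < n)%N -> padic_ideal p 0 (B (n - 4)%N) ->
  padic_ideal p 5 (power_sum p n -
    (p%:R * B n + p%:R ^+ 3 * (n%:R * (n%:R - 1) / 6) * B (n - 2)%N)).
Proof.
move=> hB pp p10 ev_n n4 intB.
have := faulhaber_padic hB pp p10 (isT : 5 <= 5)%N (ltn_trans _ n4) n4.
rewrite !big_nat_recr //= big_geq // (bernoulli_odd hB (n := (n - 1)%N)); try lia.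
rewrite (bernoulli_odd hB (n := (n - 3)%N)); try lia.
rewrite subn0 bin0 => /(_ isT) h.
have C2 : 'C(n, 2)%:R = n%:R * (n%:R - 1) / 2 :> rat.
  have := congr1 (fun k => k%:R : rat) (bin_ffact n 2).
  rewrite /= ffactnS ffactn1 !natrM -subn1 natrB; last lia.
  by move=> <-; rewrite mulfK.
rewrite C2 in h.
set x := (X in padic_ideal p 5 X) in h.
rewrite (_ : _ - _ = x + p%:R ^+ 5 * ('C(n, 4)%:R * B (n - 4)%N / 5)); last by rewrite /x; field.
by apply: padic_idealD => //; apply: padic_ideal_exp => //; padic_int.
Qed.

(** Comparison of [faulhaber_mod_p3] with the cubic for the class -4; only its
    linear part survives modulo p^2. *)
Lemma bernoulli_mod_p2 (B : nat -> rat) (p : nat) (h0 h1 h2 h3 : rat) (m : nat) :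
  bernoulli_seq B -> prime p -> (10 < p)%N ->
  padic_ideal p 0 h2 -> padic_ideal p 0 h3 ->
  (forall n, (p.-1 %| n + 4)%N ->
     padic_ideal p 5 (power_sum p n - n%:R * p%:R * cubic h0 h1 h2 h3 (p%:R * n%:R))) ->
  (2 < m)%N -> (p.-1 %| m + 4)%N ->
  padic_ideal p 2 (B m - m%:R * (h0 + h1 * (p%:R * m%:R))).
Proof.
move=> hB pp p10 i2 i3 hS m2 dvd_m.
have p2 : (2 < p)%N by lia.
have ev_m : ~~ odd m := even_of_dvd_predn pp p2 (isT : ~~ odd 4) dvd_m.
have intB : padic_ideal p 0 (B (m - 2)%N).
  apply: (padic_int_bernoulli (s := 6) hB pp p10); [exact: coprime_smooth|lia|].
  by rewrite -[6%N]/(2 + 4)%N addnA subnK // ltnW.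
have hF := faulhaber_mod_p3 hB pp p10 ev_m m2 intB.
apply: (@padic_ideal_divX p 1) => //.
rewrite (_ : _ * _ = (power_sum p m - m%:R * p%:R * cubic h0 h1 h2 h3 (p%:R * m%:R))
   - (power_sum p m - p%:R * B m)
   + p%:R ^+ 3 * (m%:R ^+ 3 * (h2 + h3 * (p%:R * m%:R)))); last by rewrite /cubic; ring.
apply: padic_idealD => //; last by apply: padic_ideal_exp => //; padic_int.
by apply: padic_idealB => //; apply: padic_ideal_le (hS m dvd_m).
Qed.

(** Comparison of [faulhaber_mod_p5] with the cubic for the class -2; the
    index n - 2 lies in the class -4, where [bernoulli_mod_p2] applies. *)
Lemma bernoulli_mod_p4 (B : nat -> rat) (p : nat) (g0 g1 g2 g3 h0 h1 : rat) (n : nat) :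
  bernoulli_seq B -> prime p -> (10 < p)%N ->
  (forall n, (p.-1 %| n + 2)%N ->
     padic_ideal p 5 (power_sum p n - n%:R * p%:R * cubic g0 g1 g2 g3 (p%:R * n%:R))) ->
  (forall m, (2 < m)%N -> (p.-1 %| m + 4)%N ->
     padic_ideal p 2 (B m - m%:R * (h0 + h1 * (p%:R * m%:R)))) ->
  (4 < n)%N -> (p.-1 %| n + 2)%N ->
  padic_ideal p 4 (B n - n%:R * (cubic g0 g1 g2 g3 (p%:R * n%:R)
     - p%:R ^+ 2 * ((n%:R - 1) * (n%:R - 2) / 6) * (h0 + h1 * (p%:R * (n%:R - 2))))).
Proof.
move=> hB pp p10 hS hB4 n4 dvd_n.
have p2 : (2 < p)%N by lia.
have ev_n : ~~ odd n := even_of_dvd_predn pp p2 (isT : ~~ odd 2) dvd_n.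
have intB : padic_ideal p 0 (B (n - 4)%N).
  apply: (padic_int_bernoulli (s := 6) hB pp p10); [exact: coprime_smooth|lia|].
  by rewrite (_ : n - 4 + 6 = n + 2)%N //; lia.
have hF := faulhaber_mod_p5 hB pp p10 ev_n n4 intB.
have /(padic_idealP _ _ pp)[y hy By] : padic_ideal p 2 (B (n - 2)%N -
    (n%:R - 2) * (h0 + h1 * (p%:R * (n%:R - 2)))).
  have -> : n%:R - 2 = (n - 2)%:R :> rat by rewrite natrB //; lia.
  by apply: hB4; [lia|rewrite (_ : n - 2 + 4 = n + 2)%N //; lia].
apply: (@padic_ideal_divX p 1) => //.
rewrite (_ : _ * _ = (power_sum p n - n%:R * p%:R * cubic g0 g1 g2 g3 (p%:R * n%:R))
   - (power_sum p n - (p%:R * B n + p%:R ^+ 3 * (n%:R * (n%:R - 1) / 6) * B (n - 2)%N))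
   + p%:R ^+ 5 * (- (n%:R * (n%:R - 1) / 6) * y)).
  by apply: padic_idealD => //; [apply: padic_idealB => //; exact: hS|apply: padic_ideal_exp => //; padic_int].
by move/eqP: By; rewrite subr_eq => /eqP ->; field.
Qed.

(** * The central binomial coefficient *)

(** Elementary symmetric functions of degree at most 3, written through power
    sums by Newton's identities. *)
Lemma prod_1B_expansion (p : nat) (r : seq nat) (f : nat -> rat) (y : rat) :
  prime p -> (10 < p)%N -> padic_ideal p 0 y -> {in r, forall k, padic_ideal p 0 (f k)} ->
  let P j := \sum_(k <- r) f k ^+ j in
  exists2 c, padic_ideal p 0 c &
    \prod_(k <- r) (1 - y * f k) =
    1 - y * P 1%N + y ^+ 2 * ((P 1%N ^+ 2 - P 2) / 2)
    - y ^+ 3 * ((P 1%N ^+ 3 - 3 * P 1%N * P 2 + 2 * P 3) / 6) + y ^+ 4 * c.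
Proof.
move=> pp p10 hy; elim: r => [|k r IHr] hf P.
  exists 0; first exact: padic_ideal0.
  by rewrite /P !big_nil; field.
have hfr : {in r, forall k, padic_ideal p 0 (f k)}.
  by move=> i ir; apply: hf; rewrite inE ir orbT.
have [c hc] := IHr hfr; rewrite big_cons => ->.
have hfk : padic_ideal p 0 (f k) by apply: hf; rewrite inE eqxx.
rewrite /P !big_cons; set P1 := \sum_(j <- r) f j ^+ 1.
set P2 := \sum_(j <- r) f j ^+ 2; set P3 := \sum_(j <- r) f j ^+ 3.
have hP j : padic_ideal p 0 (\sum_(i <- r) f i ^+ j).
  by rewrite big_seq; apply: padic_ideal_sum => // i /hfr hi; padic_int.
have hP1 : padic_ideal p 0 P1 := hP 1%N.
have hP2 : padic_ideal p 0 P2 := hP 2.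
have hP3 : padic_ideal p 0 P3 := hP 3.
exists (c + f k * ((P1 ^+ 3 - 3 * P1 * P2 + 2 * P3) / 6) - y * f k * c).
  by padic_int.
by field.
Qed.

(** The binomial is the product of the (p + k)/k, and the product of the
    (p - k)/k is 1. *)
Lemma central_binomial_prod (p : nat) : prime p -> (2 < p)%N ->
  'C(2 * p - 1, p - 1)%:R = \prod_(1 <= k < p) (1 - p%:R ^+ 2 * (k%:R ^+ 2)^-1) :> rat.
Proof.
move=> pp p2; have p0 := prime_gt0 pp.
have k0 k : (1 <= k < p)%N -> k%:R != 0 :> rat by case/andP; rewrite pnatr_eq0 -lt0n.
have facE : (p.-1)`!%:R = \prod_(1 <= k < p) k%:R :> rat.
  by rewrite fact_prod prednK // natr_prod.
have up : \prod_(1 <= k < p) (p + k)%:R = 'C(2 * p - 1, p - 1)%:R * (p.-1)`!%:R :> rat.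
  rewrite -natr_prod -subn1 -natrM bin_ffact ffact_prod; congr (_%:R).
  rewrite big_add1 big_nat_rev big_mkord subn1; apply: eq_bigr => i _.
  have := ltn_ord i; lia.
have down : \prod_(1 <= k < p) (p%:R - k%:R) = (p.-1)`!%:R :> rat.
  rewrite facE big_nat_rev /=; apply: eq_big_nat => k /andP[k1 kp].
  by rewrite -natrB; [congr (_%:R); lia|lia].
have fac0 : (p.-1)`!%:R != 0 :> rat by rewrite pnatr_eq0 -lt0n fact_gt0.
have sgn : \prod_(1 <= k < p) (- 1) = 1 :> rat.
  rewrite prodr_const_nat -signr_odd; have : odd p by case: (even_prime pp) => // pE; rewrite pE in p2.
  by rewrite -(prednK p0) /= subn1 /= => /negbTE ->.
have -> : \prod_(1 <= k < p) (1 - p%:R ^+ 2 * (k%:R ^+ 2)^-1) =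
  \prod_(1 <= k < p) ((p + k)%:R * (p%:R - k%:R) * (k%:R^-1) ^+ 2 * - 1 : rat).
  by apply: eq_big_nat => k /k0 hk; rewrite natrD; field.
rewrite !big_split /= sgn up down prodfV -facE.
by field.
Qed.

(** The expansion of the product with y = p^2.  The cubic term carries p^6, and
    each of its monomials has a factor H_2, H_4 or H_6, which is divisible by p. *)
Lemma central_binomial_mod_p7 (p : nat) : prime p -> (10 < p)%N ->
  padic_ideal p 1 (inverse_sum p 2) -> padic_ideal p 1 (inverse_sum p 4) ->
  padic_ideal p 1 (inverse_sum p 6) ->
  padic_ideal p 7 ('C(2 * p - 1, p - 1)%:R -
    (1 - p%:R ^+ 2 * inverse_sum p 2
     + p%:R ^+ 4 * ((inverse_sum p 2 ^+ 2 - inverse_sum p 4) / 2))).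
Proof.
move=> pp p10 h2 h4 h6.
have hf : {in index_iota 1 p, forall k, padic_ideal p 0 ((k%:R ^+ 2)^-1)}.
  by move=> k /(padic_unit_small pp)/(padic_unitX 2 pp)[].
have := prod_1B_expansion pp p10 (padic_idealX 2 pp (padic_int_nat p p)) hf.
rewrite -central_binomial_prod // ?(ltn_trans _ p10) // => -[c hc ->].
have P j : \sum_(1 <= k < p) ((k%:R ^+ 2)^-1) ^+ j = inverse_sum p (2 * j).
  by apply: eq_bigr => k _; rewrite exprVn -exprM.
rewrite !P; have i2 : padic_ideal p 0 (inverse_sum p 2) := padic_ideal_le (leq0n 1) h2.
rewrite (_ : _ - _ = p%:R ^+ 6 * (- ((inverse_sum p 2 ^+ 3 - 3 * inverse_sum p 2 * inverse_sum p 4 + 2 * inverse_sum p 6) / 6))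
  + p%:R ^+ 7 * (p%:R * c)); last by rewrite ![(2 * _)%N]/=; field.
have int4 : padic_ideal p 0 (inverse_sum p 4) := padic_ideal_le (leq0n 1) h4.
apply: padic_idealD => //; last by apply: padic_ideal_exp => //; padic_int.
apply: (padic_idealM (e := 6) (f := 1)) => //; first exact: padic_ideal_natX.
apply: padic_idealN; apply: padic_idealMr => //; last by padic_int.
apply: padic_idealD => //; last by apply: padic_idealMl => //; padic_int.
apply: padic_idealB => //; first by rewrite exprS; apply: padic_idealMr => //; padic_int.
by apply: padic_idealMl => //; padic_int.
Qed.

(** * The expansion in Bernoulli numbers *)

(** The primes 2, 3, 5 and 7 are excluded by computation. *)
Lemma wolstenholme_prime_gt10 (p : nat) : wolstenholme_prime p -> (10 < p)%N.
Proof.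
rewrite ltnNge => /andP[pp wp]; apply: contraL wp => p10.
by move: p p10 pp; do 11!case=> //.
Qed.

(** Extrapolation to t = 0 is exact on the polynomials that interpolate the
    quotients b n, so the errors in the b n are the only ones.  Besides the
    congruence, the divisibilities are what the passage from b n back to B n
    uses. *)
Lemma central_binomial_divided_bernoulli (p : nat) (B : nat -> rat) :
  wolstenholme_prime p -> bernoulli_seq B ->
  let b n := B n / n%:R in
  [/\ padic_ideal p 7 ('C(2 * p - 1, p - 1)%:R -
        (1 + 2 * p%:R ^+ 3 * (4 * b (p - 3)%N - 6 * b (2 * p - 4)%N
                              + 4 * b (3 * p - 5)%N - b (4 * p - 6)%N)
         + 6 * p%:R ^+ 5 * (2 * b (p - 5)%N - b (2 * p - 6)%N))),
      [/\ padic_ideal p 1 (b (p - 3)%N), padic_ideal p 1 (b (2 * p - 4)%N),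
          padic_ideal p 1 (b (3 * p - 5)%N) & padic_ideal p 1 (b (4 * p - 6)%N)],
      padic_ideal p 0 (b (p - 5)%N) & padic_ideal p 1 (b (p - 5)%N - b (2 * p - 6)%N)].
Proof.
move=> wp hB b; have p10 := wolstenholme_prime_gt10 wp.
have /andP[pp /eqP wpE] := wp; have p2 : (2 < p)%N by lia.
have p0 : p%:R != 0 :> rat by rewrite pnatr_eq0 -lt0n prime_gt0.
have int_p := padic_int_nat p p.
have co2 : coprime p (2 ^ 2 - 1) by exact: coprime_smooth.
have co4 : coprime p (2 ^ 4 - 1) by exact: coprime_smooth.
have co6 : coprime p (2 ^ 6 - 1) by exact: coprime_smooth.
have [g0 [g1 [g2 [g3 [ig0 ig1 ig2 ig3 hG]]]]] := power_sum_poly pp p10 co2.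
have [h0 [h1 [h2 [h3 [ih0 ih1 ih2 ih3 hH]]]]] := power_sum_poly pp p10 co4.
have [k0 [k1 [k2 [k3 [ik0 ik1 ik2 ik3 hK]]]]] := power_sum_poly pp p10 co6.
have H2 := inverse_sum_poly pp p2 (ltac:(lia) : (2 <= p)%N) ig0 ig1 ig2 ig3 hG.
have H4 := inverse_sum_poly pp p2 (ltac:(lia) : (4 <= p)%N) ih0 ih1 ih2 ih3 hH.
have H6 := inverse_sum_poly pp p2 (ltac:(lia) : (6 <= p)%N) ik0 ik1 ik2 ik3 hK.
have mod1 s x : padic_ideal p 0 x ->
    padic_ideal p 5 (inverse_sum p s + s%:R * p%:R * x) -> padic_ideal p 1 (inverse_sum p s).
  move=> hx hs; rewrite -[inverse_sum p s](addrK (s%:R * p%:R * x)).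
  apply: padic_idealB => //; first exact: padic_ideal_le hs.
  by rewrite mulrAC mulrC -[p%:R]expr1; apply: padic_ideal_exp => //; padic_int.
have H2_1 : padic_ideal p 1 (inverse_sum p 2) by apply: mod1 H2; rewrite /cubic; padic_int.
have H4_1 : padic_ideal p 1 (inverse_sum p 4) by apply: mod1 H4; rewrite /cubic; padic_int.
have H6_1 : padic_ideal p 1 (inverse_sum p 6) by apply: mod1 H6; rewrite /cubic; padic_int.
have hC := central_binomial_mod_p7 pp p10 H2_1 H4_1 H6_1.
have int2 : padic_ideal p 0 (inverse_sum p 2) := padic_ideal_le (leq0n 1) H2_1.
have int4 : padic_ideal p 0 (inverse_sum p 4) := padic_ideal_le (leq0n 1) H4_1.
(* The Wolstenholme condition, read in the expansion modulo p^4. *)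
have H2_2 : padic_ideal p 2 (inverse_sum p 2).
  have C4 := padic_ideal_natB wpE.
  apply: (@padic_ideal_divX p 2) => //.
  rewrite (_ : _ * _ = ('C(2 * p - 1, p - 1)%:R -
    (1 - p%:R ^+ 2 * inverse_sum p 2
     + p%:R ^+ 4 * ((inverse_sum p 2 ^+ 2 - inverse_sum p 4) / 2)))
    - ('C(2 * p - 1, p - 1)%:R - 1)
    + p%:R ^+ 4 * ((inverse_sum p 2 ^+ 2 - inverse_sum p 4) / 2)); last by field.
  apply: padic_idealD => //; last by apply: padic_ideal_exp => //; padic_int.
  by apply: padic_idealB => //; apply: padic_ideal_le hC.
(* H_2 is -2 p g0 modulo p^2, and the Wolstenholme condition makes it 0. *)
have g0_1 : padic_ideal p 1 g0.
  apply: (@padic_ideal_divX p 1) => //.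
  rewrite (_ : _ * g0 = (inverse_sum p 2 + 2 * p%:R * cubic g0 g1 g2 g3 (- (p%:R * 2))) / 2
    - inverse_sum p 2 / 2 + p%:R ^+ 2 * (2 * (g1 - 2 * p%:R * g2 + 4 * p%:R ^+ 2 * g3)));
    last by rewrite /cubic; field.
  apply: padic_idealD => //; last by apply: padic_ideal_exp => //; padic_int.
  apply: padic_idealB => //; apply: padic_idealMr => //; try by padic_int.
  exact: padic_ideal_le H2.
(* p-adic interpolations: B_m/m is L(m) modulo p^2 in the class -4, and B_n/n
   is Q(n) modulo p^4 in the class -2. *)
pose L (z : rat) := h0 + h1 * (p%:R * z).
pose Q (z : rat) := cubic g0 g1 g2 g3 (p%:R * z)
  - p%:R ^+ 2 * ((z - 1) * (z - 2) / 6) * L (z - 2).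
have hB4 := bernoulli_mod_p2 hB pp p10 ih2 ih3 hH.
have hB2 := bernoulli_mod_p4 hB pp p10 hG (fun m => @hB4 m).
have unit_n t s n : (0 < t + s < 11)%N -> n = (t * p - (t + s))%N -> (t + s <= t * p)%N ->
    padic_unit p n%:R.
  move=> /andP[ts0 ts11] -> le; apply: padic_unit_nat => //; rewrite prime_coprime //.
  apply/negP => pn; have : (p %| t + s)%N.
    by rewrite -(dvdn_addr _ pn) subnK // dvdn_mull.
  by move=> /(dvdn_leq ts0); lia.
have ntE t s n : n = (t * p - (t + s))%N -> (t + s <= t * p)%N ->
    n%:R = t%:R * (p%:R - 1) - s%:R :> rat.
  by move=> -> le; rewrite natrB // natrD natrM; ring.
have dvd_n t s n : n = (t * p - (t + s))%N -> (t + s <= t * p)%N -> (p.-1 %| n + s)%N.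
  move=> -> le; apply/dvdnP; exists t.
  rewrite -subn1 mulnBr muln1; lia.
(* The indices are n = t p - (t + s), that is t (p - 1) - s. *)
have quot2 t n : (0 < t < 5)%N -> n = (t * p - (t + 2))%N ->
    padic_ideal p 4 (b n - Q (t%:R * (p%:R - 1) - 2)).
  move=> /andP[t0 t5] nE; have le : (t + 6 < t * p)%N by nia.
  have le2 : (t + 2 <= t * p)%N by lia.
  rewrite -(ntE t 2%N n nE le2); apply: padic_ideal_div_unit => //.
    by apply: (unit_n t 2%N) => //; lia.
  by apply: hB2; [lia|apply: (dvd_n t)].
have quot4 t n : (0 < t < 5)%N -> n = (t * p - (t + 4))%N ->
    padic_ideal p 2 (b n - L (t%:R * (p%:R - 1) - 4)).
  move=> /andP[t0 t5] nE; have le : (t + 6 < t * p)%N by nia.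
  have le2 : (t + 4 <= t * p)%N by lia.
  rewrite -(ntE t 4%N n nE le2); apply: padic_ideal_div_unit => //.
    by apply: (unit_n t 4%N) => //; lia.
  by apply: hB4; [lia|apply: (dvd_n t)].
have b1 := quot2 1%N (p - 3)%N isT ltac:(lia).
have b2 := quot2 2%N (2 * p - 4)%N isT ltac:(lia).
have b3 := quot2 3%N (3 * p - 5)%N isT ltac:(lia).
have b4 := quot2 4%N (4 * p - 6)%N isT ltac:(lia).
have c1 := quot4 1%N (p - 5)%N isT ltac:(lia).
have c2 := quot4 2%N (2 * p - 6)%N isT ltac:(lia).
have Q1 z : padic_ideal p 0 z -> padic_ideal p 1 (Q z).
  move=> hz; rewrite (_ : Q z = g0 + p%:R ^+ 1 * (z * (g1 + g2 * (p%:R * z) + g3 * (p%:R * z) ^+ 2)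
    - p%:R * ((z - 1) * (z - 2) / 6) * L (z - 2))); last by rewrite /Q /cubic; ring.
  by apply: padic_idealD => //; apply: padic_ideal_exp => //; rewrite /L; padic_int.
have b_1 t n : padic_ideal p 4 (b n - Q (t%:R * (p%:R - 1) - 2)) -> padic_ideal p 1 (b n).
  move=> hb; rewrite -(subrK (Q (t%:R * (p%:R - 1) - 2)) (b n)).
  by apply: padic_idealD => //; [exact: padic_ideal_le hb|apply: Q1; padic_int].
split.
- set C := _%:R in hC *.
  (* The main terms cancel by extrapolation to t = 0 of Q, cubic in t, and of
     L, linear in t: -p^2 H_2 contributes 2 p^3 Q(-2) + 4 p^5 L(-4), and
     -p^4 H_4/2 contributes 2 p^5 L(-4). *)
  rewrite (_ : _ - _ =
     (C - (1 - p%:R ^+ 2 * inverse_sum p 2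
     + p%:R ^+ 4 * ((inverse_sum p 2 ^+ 2 - inverse_sum p 4) / 2)))
     - p%:R ^+ 2 * (inverse_sum p 2 + 2 * p%:R * cubic g0 g1 g2 g3 (- (p%:R * 2)))
     + p%:R ^+ 4 * (inverse_sum p 2 ^+ 2 / 2)
     - p%:R ^+ 4 * ((inverse_sum p 4 + 4 * p%:R * cubic h0 h1 h2 h3 (- (p%:R * 4))) / 2)
     + p%:R ^+ 7 * (2 * (16 * h2 - 64 * p%:R * h3))
     - p%:R ^+ 3 * (2 * (4 * (b (p - 3)%N - Q (1 * (p%:R - 1) - 2))
        - 6 * (b (2 * p - 4)%N - Q (2 * (p%:R - 1) - 2))
        + 4 * (b (3 * p - 5)%N - Q (3 * (p%:R - 1) - 2))
        - (b (4 * p - 6)%N - Q (4 * (p%:R - 1) - 2))))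
     - p%:R ^+ 5 * (6 * (2 * (b (p - 5)%N - L (1 * (p%:R - 1) - 4))
        - (b (2 * p - 6)%N - L (2 * (p%:R - 1) - 4))))); last first.
    by rewrite /Q /L /cubic; field.
  have scale k e y : padic_ideal p e y -> padic_ideal p (k + e) (p%:R ^+ k * y).
    by apply: padic_idealM => //; apply: padic_ideal_natX.
  apply: padic_idealB => //; last first.
    apply: (scale 5%N 2%N); apply: padic_idealMl => //; first exact: padic_int_nat.
    by apply: padic_idealB => //; apply: padic_idealMl => //; apply: padic_int_nat.
  apply: padic_idealB => //; last first.
    apply: (scale 3%N 4%N); apply: padic_idealMl => //; first exact: padic_int_nat.
    apply: padic_idealB => //; apply: padic_idealD => //; last by apply: padic_idealMl => //; apply: padic_int_nat.
    by apply: padic_idealB => //; apply: padic_idealMl => //; apply: padic_int_nat.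
  apply: padic_idealD => //; last by apply: padic_ideal_exp => //; padic_int.
  apply: padic_idealB => //; last first.
    by apply: (padic_ideal_le (isT : 7 <= 4 + 5)%N); apply: scale; apply: padic_idealMr => //; padic_int.
  apply: padic_idealD => //; last first.
    apply: (padic_ideal_le (isT : 7 <= 4 + (2 + 2))%N); apply: scale.
    by apply: padic_idealMr => //; [rewrite expr2; apply: padic_idealM|padic_int].
  by apply: padic_idealB => //; apply: (scale 2%N 5%N).
- by split; [apply: (b_1 1%N) b1|apply: (b_1 2%N) b2|apply: (b_1 3%N) b3|apply: (b_1 4%N) b4].
- rewrite -(subrK (L (1%N%:R * (p%:R - 1) - 4)) (b _)).
  by apply: padic_idealD; [by []|apply: padic_ideal_le c1|rewrite /L; padic_int].
rewrite (_ : _ - _ = (b (p - 5)%N - L (1%N%:R * (p%:R - 1) - 4))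
  - (b (2 * p - 6)%N - L (2 * (p%:R - 1) - 4)) - p%:R ^+ 1 * (h1 * (p%:R - 1))); last first.
  by rewrite /L; ring.
apply: padic_idealB => //; last by apply: padic_ideal_exp => //; padic_int.
by apply: padic_idealB => //; [apply: padic_ideal_le c1|apply: padic_ideal_le c2].
Qed.

Theorem corollary3 (p : nat) (B : nat -> rat) :
  wolstenholme_prime p -> bernoulli_seq B ->
  ratcong p 7
    ('C(2 * p - 1, p - 1))%:R
    (1
     - p%:R ^+ 3 * (8 / 3 * B (p - 3)%N - 3 * B (2 * p - 4)%N
                    + 8 / 5 * B (3 * p - 5)%N - 1 / 3 * B (4 * p - 6)%N)
     - p%:R ^+ 4 * (8 / 9 * B (p - 3)%N - 3 / 2 * B (2 * p - 4)%N
                    + 24 / 25 * B (3 * p - 5)%N - 2 / 9 * B (4 * p - 6)%N)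
     - p%:R ^+ 5 * (8 / 27 * B (p - 3)%N - 3 / 4 * B (2 * p - 4)%N
                    + 72 / 125 * B (3 * p - 5)%N - 4 / 27 * B (4 * p - 6)%N
                    + 12 / 5 * B (p - 5)%N - B (2 * p - 6)%N)
     - 2 / 25 * p%:R ^+ 6 * B (p - 5)%N).
Proof.
move=> wp hB; have p10 := wolstenholme_prime_gt10 wp.
have /andP[pp _] := wp; have int_p := padic_int_nat p p.
have [] := central_binomial_divided_bernoulli wp hB.
have BE n : (0 < n)%N -> B n = n%:R * (B n / n%:R).
  by move=> n0; rewrite mulrCA divff ?mulr1 // pnatr_eq0 -lt0n.
have nE t s : (s <= t * p)%N -> (t * p - s)%:R = t%:R * p%:R - s%:R :> rat.
  by move=> le; rewrite natrB // natrM.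
have E1 := BE (p - 3)%N ltac:(lia); have E2 := BE (2 * p - 4)%N ltac:(lia).
have E3 := BE (3 * p - 5)%N ltac:(lia); have E4 := BE (4 * p - 6)%N ltac:(lia).
have E5 := BE (p - 5)%N ltac:(lia); have E6 := BE (2 * p - 6)%N ltac:(lia).
move: E1 E2 E3 E4 E5 E6; set C := 'C(_, _)%:R.
set b1 := B (p - 3)%N / _; set b2 := B (2 * p - 4)%N / _; set b3 := B (3 * p - 5)%N / _.
set b4 := B (4 * p - 6)%N / _; set c1 := B (p - 5)%N / _; set c2 := B (2 * p - 6)%N / _.
move=> -> -> -> -> -> -> hC [h1 h2 h3 h4] hc1 hc12.
apply: ratcong_padic => //.
rewrite (nE 2%N) ?(nE 3%N) ?(nE 4%N) ?(nE 2%N 6%N) ?natrB; try lia.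
(* For q = p/3, p/2, 3p/5, 2p/3 the index n is a constant times 1 - q, so
   n (1 + q + q^2) is that constant times 1 - q^3; the summand with p^6 collects
   the q^3. *)
rewrite (_ : C - _ = (C - (1 + 2 * p%:R ^+ 3 * (4 * b1 - 6 * b2 + 4 * b3 - b4)
         + 6 * p%:R ^+ 5 * (2 * c1 - c2)))
   + p%:R ^+ 6 * (8 / 27 * b1 - 3 / 2 * b2 + 216 / 125 * b3 - 16 / 27 * b4 + 2 * (c1 - c2))
   + p%:R ^+ 7 * (2 / 25 * c1)); last by field.
apply: padic_idealD => //; last by apply: padic_ideal_exp => //; padic_int.
apply: padic_idealD => //; apply: (padic_idealM (e := 6) (f := 1)) => //.
  exact: padic_ideal_natX.
apply: padic_idealD => //; last by apply: padic_idealMl => //; padic_int.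
apply: padic_idealB => //; last by apply: padic_idealMl => //; padic_int.
apply: padic_idealD => //; last by apply: padic_idealMl => //; padic_int.
by apply: padic_idealB => //; apply: padic_idealMl => //; padic_int.
Qed.
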